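(* For $b\in[0,1]$ let $f_b$ denote the density of the distribution function $F_b=G_b^{-1}$ on $[0,1]$ defined in the context, and let $x_b=e^{1-b}-(1-b)e$. Then $f_1\equiv1$, and for $b\in[0,1)$: (i) $f_b(x)=e^{b-1}$ for $0\le x<x_b$; (ii) $f_b(x_b^+)=\dfrac{e^{b-1}}{1-e^{-b}}$ (right-hand limit at $x_b$, interpreted as $+\infty$ when $b=0$); (iii) $f_b(x)$ is decreasing and convex for $x\in(x_b,1]$; (iv) $f_b(1)=\dfrac{e^{b-1}}{1-e^{-1}}$.
   Context: For $b\in[0,1]$ define the increasing bijection $G_b:[0,1]\to[0,1]$ by $G_b(y)=ye^{1-b}$ for $0\le y\le 1-(1-b)e^b$ and $G_b(y)=e^{(1-y)e^{-b}}-(1-y)e^{1-b}$ for $1-(1-b)e^b\le y\le1$, and let $F_b=G_b^{-1}$, a distribution function on $[0,1]$. The density is $f_b=F_b'$ (one-sided derivatives at the endpoints of $[0,1]$; note $x_b=G_b(1-(1-b)e^b)$ is the only possible point in $(0,1)$ of non-differentiability). Probabilistic meaning: $F_b$ is the limiting distribution function of $\frac1n$ times the final position of card number $b_nn$ (with $b_n\to b$) after one card-cyclic to random insertion shuffle of $n$ cards started in increasing order, i.e. the shuffle in which cards $1,2,\dots,n$ are, in this order, each removed once and reinserted in a uniformly random one of the $n$ positions. *)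

(* Defs.v *)
From HB Require Import structures.
From mathcomp Require Import all_boot all_order all_algebra.
From mathcomp Require Import all_classical all_reals all_analysis.
Set Implicit Arguments.
Unset Strict Implicit.
Unset Printing Implicit Defensive.
Import Order.TTheory GRing.Theory Num.Theory.
Import numFieldNormedType.Exports.
Local Open Scope classical_set_scope.
Local Open Scope ring_scope.

(* The first branch is used on [0, y_b] and the second on [y_b, 1]; they agree
   at the breakpoint y_b = 1 - (1 - b) e^b. *)
Definition Gcyc (R : realType) (b y : R) : R :=
  if y <= 1 - (1 - b) * expR b then y * expR (1 - b)
  else expR ((1 - y) * expR (- b)) - (1 - y) * expR (1 - b).

(* The inverse of [Gcyc b] as a function from [0, 1] to [0, 1]; its values
   outside [0, 1] are irrelevant. *)
Definition Fcyc (R : realType) (b : R) : R -> R := pinv (`[0, 1] : set R) (Gcyc b).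

Definition xbreak (R : realType) (b : R) : R :=
  expR (1 - b) - (1 - b) * expR 1.

(* How an increment h tends to 0 in the derivative at x of a function on
   [0, 1]: one-sided at the endpoints. *)
Definition incr01 (R : realType) (x : R) : set_system R :=
  if x == 0 then 0^'+ else if x == 1 then 0^'- else 0^'.

Definition derivable01 (R : realType) (F : R -> R) (x : R) : Prop :=
  cvg ((fun h => h^-1 *: (F (h + x) - F x)) @ incr01 x).

Definition derive01 (R : realType) (F : R -> R) (x : R) : R :=
  lim ((fun h => h^-1 *: (F (h + x) - F x)) @ incr01 x).

Lemma derive01E (R : realType) (F : R -> R) (x : R) :
  0 < x < 1 -> derive01 F x = derive1 F x.
Proof. by case/andP=> x0 x1; rewrite /derive01 /incr01 gt_eqF// lt_eqF. Qed.

Definition fcyc (R : realType) (b : R) : R -> R := derive01 (Fcyc b).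

(* Main.v *)
(** In the variable u = (1 - y) e^-b, the second branch of G_b becomes
    X u = e^u - u e, which does not depend on b. Hence with U the inverse of X,
    F_b x = 1 - e^b U x on [x_b, 1] and f_b (X u) = e^b / (e - e^u) for
    0 <= u < 1 - b, where X decreases. Monotonicity and both limit values are
    read off this parametrization. Convexity follows from the existence of
    supporting lines: for fixed c, the derivative in u of
    1 / (e - e^u) + e^c / (e - e^c)^3 * X u has the sign of u - c. *)

Require Import Defs.
From HB Require Import structures.
From mathcomp Require Import all_boot all_order all_algebra.
From mathcomp Require Import all_classical all_reals all_analysis.
From mathcomp Require Import ring lra.
Set Implicit Arguments.
Unset Strict Implicit.
Unset Printing Implicit Defensive.
Import Order.TTheory GRing.Theory Num.Theory.
Import numFieldNormedType.Exports.
Local Open Scope classical_set_scope.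
Local Open Scope ring_scope.

(** * The function X and its inverse U *)

Definition cycX (R : realType) (u : R) : R := expR u - u * expR 1.

(* The interval extends beyond 0 on the left so that [cycU] is two-sidedly
   differentiable at 1 = [cycX 0]. *)
Definition cycU (R : realType) : R -> R := pinv (`[-1, 1] : set R) (@cycX R).

Lemma cycX0 (R : realType) : cycX (0 : R) = 1.
Proof. by rewrite /cycX expR0 mul0r subr0. Qed.

Lemma cycX1 (R : realType) : cycX (1 : R) = 0.
Proof. by rewrite /cycX mul1r subrr. Qed.

(** The strict inequality [1 + t < e^t] at [t = u - v] gives [X u - X v > (u - v) (e^v - e)], a
    product of two nonpositive factors. This includes [v = 1], where [X'] vanishes. *)
Lemma cycX_lt (R : realType) (u v : R) : v <= 1 -> u < v -> cycX v < cycX u.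
Proof.
move=> v1 uv.
have := @expR_gt1Dx R (u - v); rewrite subr_eq0 lt_eqF// => /(_ isT) h.
have -> : cycX u = expR v * expR (u - v) - u * expR 1.
  by rewrite -expRD subrKC.
have v0 := expR_gt0 v.
have ve : expR v <= expR 1 by rewrite ler_expR.
rewrite /cycX; nra.
Qed.

Lemma cycX_inj (R : realType) (u v : R) :
  u <= 1 -> v <= 1 -> cycX u = cycX v -> u = v.
Proof.
move=> u1 v1 uv; have [/(cycX_lt v1)|/(cycX_lt u1)|//] := ltgtP u v;
  by rewrite uv ltxx.
Qed.

Lemma ltr_cycX (R : realType) (u v : R) :
  u <= 1 -> v <= 1 -> (cycX u < cycX v) = (v < u).
Proof.
move=> u1 v1; have [vu|/(cycX_lt v1)|->] := ltgtP v u.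
- exact: cycX_lt.
- by move/ltW/le_gtF.
- by rewrite ltxx.
Qed.

Lemma cycX_itv (R : realType) (u : R) : 0 <= u <= 1 -> 0 <= cycX u <= 1.
Proof.
move=> /andP[u0 u1].
rewrite -[X in X <= _](cycX1 R) -[X in _ && (_ <= X)](cycX0 R).
by rewrite !leNgt !ltr_cycX//; lra.
Qed.

Lemma cycUK (R : realType) (u : R) : -1 <= u <= 1 -> cycU (cycX u) = u.
Proof.
move=> u1; apply: pinvKV; last by rewrite inE/= in_itv.
move=> x y; rewrite !inE/= !in_itv/= => /andP[_ x1] /andP[_ y1].
exact: cycX_inj.
Qed.

#[global] Instance is_derive_cycX (R : realType) (u : R) :
  is_derive u 1 (@cycX R) (expR u - expR 1).
Proof.
rewrite /cycX; apply: is_derive_eq.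
by rewrite !scaler0 add0r [X in _ - X]mulr1.
Qed.

Lemma cycX_surj (R : realType) (x : R) :
  0 <= x <= 1 -> exists2 u, 0 <= u <= 1 & cycX u = x.
Proof.
move=> x01; have [||u u01 uE] := @IVT R (@cycX R) 0 1 x ler01.
- by apply: derivable_within_continuous => z _; exact: ex_derive.
- by rewrite cycX0 cycX1 min_r ?max_l ?ler01.
- by exists u.
Qed.

(** Inverse function rule; [u = 1] is excluded because [X' 1 = 0]. *)
Lemma is_derive_cycU (R : realType) (u : R) :
  -1 < u < 1 -> is_derive (cycX u) 1 (@cycU R) (expR u - expR 1)^-1.
Proof.
move=> /andP[u0 u1]; apply: (@is_derive_inverse R (@cycX R)).
- near=> z; apply: cycUK; apply/andP; split; apply: ltW; near: z.
    exact: lt_nbhsr.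
  exact: lt_nbhsl.
- near=> z; apply: differentiable_continuous.
  by apply/derivable1_diffP; exact: ex_derive.
- by rewrite subr_eq0 lt_eqF// ltr_expR.
Unshelve. all: by end_near.
Qed.

(** * Supporting lines for the density *)

Lemma cycX_tangent (R : realType) (c u : R) : c < 1 -> u < 1 ->
  (expR 1 - expR c)^-1 - expR c / (expR 1 - expR c) ^+ 3 * (cycX u - cycX c)
  <= (expR 1 - expR u)^-1.
Proof.
move=> c1 u1.
(* [- phi c] is the slope at [u = c] of [1 / (e - e^u)] as a function of [X u], so the claim reads
   [psi c <= psi u]. As [phi] increases below 1, [dpsi w] has the sign of [w - c]. *)
pose phi (w : R) := expR w / (expR 1 - expR w) ^+ 3.
pose psi (w : R) := (expR 1 - expR w)^-1 + phi c * cycX w.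
pose dpsi (w : R) := (expR 1 - expR w) * (phi w - phi c).
have gap (w : R) : w < 1 -> 0 < expR 1 - expR w by move=> w1; rewrite subr_gt0 ltr_expR.
have psiD (w : R) : w < 1 -> is_derive w 1 psi (dpsi w).
  move=> /gap w0.
  have w0' : expR 1 - expR w != 0 by rewrite gt_eqF.
  have -> : dpsi w = - (expR 1 - expR w) ^- 2 *: (0 - expR w) +
      phi c *: (expR w - expR 1).
    by rewrite /dpsi /phi /GRing.scale/=; field; rewrite w0' gt_eqF ?gap.
  apply: is_deriveD.
  apply: (@is_deriveV R (fun y => expR 1 - expR y)) => //.
have phi_le (v w : R) : v <= w -> w < 1 -> phi v <= phi w.
  move=> vw w1; have v1 := le_lt_trans vw w1.
  have [gv gw] := (gap v v1, gap w w1).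
  apply: ler_pM; [exact: expR_ge0|by rewrite invr_ge0 exprn_ge0// ltW|
    by rewrite ler_expR|].
  rewrite lef_pV2 ?posrE ?exprn_gt0// lerXn2r ?nnegrE ?(ltW gv) ?(ltW gw)//.
  by rewrite lerD2l lerN2 ler_expR.
have psiC (a b : R) : b < 1 -> {within `[a, b], continuous psi}.
  move=> b1; apply: derivable_within_continuous => z; rewrite in_itv/= => /andP[_ zb].
  by have [] := psiD z (le_lt_trans zb b1).
suff : psi c <= psi u by rewrite /psi -/(phi c); lra.
have [cu|uc] := leP c u.
- have [z||z] := @MVT_segment R psi dpsi c u cu.
  + by rewrite in_itv/= => /andP[_ zu]; apply: psiD; exact: lt_trans zu u1.
  + exact: psiC.
  + rewrite in_itv/= => /andP[cz zu] E.
    have z1 := le_lt_trans zu u1.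
    rewrite -subr_ge0 E mulr_ge0 ?subr_ge0// mulr_ge0 ?subr_ge0 ?phi_le//.
    by rewrite ler_expR ltW.
- have [z||z] := @MVT_segment R psi dpsi u c (ltW uc).
  + by rewrite in_itv/= => /andP[_ zc]; apply: psiD; exact: lt_trans zc c1.
  + exact: psiC.
  + rewrite in_itv/= => /andP[uz zc] E.
    have z1 := le_lt_trans zc c1.
    rewrite -subr_le0 E mulr_le0_ge0 ?subr_ge0 ?(ltW uc)//.
    by rewrite mulr_ge0_le0 ?subr_ge0 ?subr_le0 ?phi_le// ler_expR ltW.
Qed.

(** * Derivatives on [0, 1], one-sided at the endpoints *)

(** This lets a two-sided derivative be restricted to the increments that [derive01] uses. *)
Lemma incr01_dnbhs (R : realType) (x : R) : incr01 x `=>` 0^'.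
Proof.
rewrite /incr01 => P; rewrite /dnbhs /at_right /at_left /within/= => P0.
have [_|_] := ifPn; last have [_|_//] := ifPn.
- by apply: (filterS _ P0) => h Ph h0; apply: Ph; rewrite gt_eqF.
- by apply: (filterS _ P0) => h Ph h0; apply: Ph; rewrite lt_eqF.
Qed.

Lemma incr01_proper (R : realType) (x : R) : ProperFilter (incr01 x).
Proof. by rewrite /incr01; case: ifP => _; [|case: ifP => _]; typeclasses eauto. Qed.

Lemma incr01_itv (R : realType) (x : R) : 0 <= x <= 1 ->
  \forall h \near incr01 x, 0 <= h + x <= 1.
Proof.
move=> /andP[x0 x1]; rewrite /incr01.
have [->|x0'] := eqVneq x 0.
  by near=> h; rewrite addr0; apply/andP; split => //; apply: ltW.
have [->|x1'] := eqVneq x 1.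
  near=> h; rewrite -lerBlDr sub0r gerDr; apply/andP; split => //.
  apply: ltW; near: h; apply: nbhs_left_gt; exact: ltrN10.
have {}x0 : 0 < x by rewrite lt_neqAle eq_sym x0'.
have {}x1 : x < 1 by rewrite lt_neqAle x1'.
apply: nbhs_dnbhs; near=> h.
rewrite -lerBlDr sub0r -lerBrDr; apply/andP; split; apply: ltW; near: h.
  by apply: lt_nbhsr; rewrite oppr_lt0.
by apply: lt_nbhsl; rewrite subr_gt0.
Unshelve. all: by end_near.
Qed.

(* The comparison function [g] must be differentiable on both sides even at the
   endpoints, where [derive01] only sees one. *)
Lemma derive01_near (R : realType) (F g : R -> R) (x l : R) :
  0 <= x <= 1 -> (\forall z \near x, 0 <= z <= 1 -> F z = g z) ->
  is_derive x 1 g l -> derivable01 F x /\ derive01 F x = l.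
Proof.
move=> x01 Fg [dg gl].
have FP := incr01_proper x.
have h : (fun h => h^-1 *: (F (h + x) - F x)) @ incr01 x --> l.
  apply: (@cvg_trans _ ((fun h => h^-1 *: (g (h *: 1 + x) - g x)) @ incr01 x)).
    apply: near_eq_cvg; near=> h.
    rewrite [h *: 1]mulr1 (nbhs_singleton Fg)//; congr (_ *: (_ - _)).
    apply/esym; have : 0 <= h + x <= 1 by near: h; exact: incr01_itv.
    near: h; apply: incr01_dnbhs; apply: nbhs_dnbhs.
    have hx : h + x @[h --> (0 : R)] --> x.
      by rewrite -[X in _ --> X]add0r; apply: cvgD; [exact: cvg_id|exact: cvg_cst].
    exact: (hx _ Fg).
  apply: cvg_trans; first exact: (cvg_app _ (@incr01_dnbhs R x)).
  by rewrite -gl; exact: dg.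
split; first by apply/cvg_ex; exists l.
exact: cvg_lim h.
Unshelve. all: by end_near.
Qed.

(** * The two branches of G_b and of its inverse F_b *)

(** Equivalent to [1 - b <= e^-b]; it places the breakpoint [y_b] at or above 0. *)
Lemma onem_expR_le1 (R : realType) (b : R) : (1 - b) * expR b <= 1.
Proof.
rewrite -ler_pdivlMr ?expR_gt0// mul1r -expRN.
exact: expR_ge1Dx.
Qed.

Lemma Gcyc_right (R : realType) (b u : R) : 0 <= u <= 1 - b ->
  Gcyc b (1 - expR b * u) = cycX u.
Proof.
move=> /andP[u0 ub]; rewrite /Gcyc /cycX.
have e0 := expR_gt0 b.
have eK : expR b * expR (- b) = 1 by rewrite -expRD subrr expR0.
have eD : expR b * expR (1 - b) = expR 1 by rewrite -expRD subrKC.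
(* The first branch of G_b can apply only when [u = 1 - b], that is at the breakpoint, where both
   formulas agree. *)
have [h|_] := leP.
  have -> : u = 1 - b.
    apply/eqP; rewrite eq_le ub/=.
    by rewrite -(ler_pM2l e0); lra.
  by rewrite mulrBl mul1r mulrAC eD; lra.
by rewrite subKr mulrAC eK mul1r mulrAC eD mulrC.
Qed.

Lemma Gcyc_left (R : realType) (b y : R) : y <= 1 - (1 - b) * expR b ->
  Gcyc b y = y * expR (1 - b).
Proof. by rewrite /Gcyc => ->. Qed.

Lemma Gcyc_break (R : realType) (b : R) :
  (1 - (1 - b) * expR b) * expR (1 - b) = xbreak b.
Proof. by rewrite /xbreak mulrBl mul1r -mulrA -expRD subrKC. Qed.

(** Each branch is injective, and [x_b] separates their values: at most [x_b] on the left, strictly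
    above it on the right. Injectivity is what makes [pinv] a left inverse of G_b. *)
Lemma Gcyc_inj (R : realType) (b : R) : 0 <= b <= 1 ->
  {in `[0, 1]%classic &, injective (Gcyc b)}.
Proof.
move=> /andP[b0 b1].
have e0 := expR_gt0 b.
have right y : 1 - (1 - b) * expR b < y -> y <= 1 ->
    exists2 u, 0 <= u < 1 - b & y = 1 - expR b * u.
  move=> yb y1; exists ((1 - y) / expR b); last by field; rewrite gt_eqF.
  by rewrite divr_ge0 ?subr_ge0 ?expR_ge0//= ltr_pdivrMr//; lra.
have cross y z : y <= 1 - (1 - b) * expR b -> 1 - (1 - b) * expR b < z ->
    z <= 1 -> Gcyc b y < Gcyc b z.
  move=> yb zb z1; have [u /andP[u0 ub] ->] := right z zb z1.
  rewrite Gcyc_left// Gcyc_right ?u0 ?ltW//.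
  apply: (@le_lt_trans _ _ (xbreak b)); last by rewrite ltr_cycX//; lra.
  by rewrite -Gcyc_break ler_pM2r ?expR_gt0.
move=> y z; rewrite !inE/= !in_itv/= => /andP[y0 y1] /andP[z0 z1] E.
have [yb|yb] := leP y (1 - (1 - b) * expR b);
  have [zb|zb] := leP z (1 - (1 - b) * expR b).
- move: E; rewrite !Gcyc_left// => /mulIf; apply.
  by rewrite gt_eqF ?expR_gt0.
- by have := cross _ _ yb zb z1; rewrite E ltxx.
- by have := cross _ _ zb yb y1; rewrite E ltxx.
- have [u /andP[u0 ub] yE] := right y yb y1.
  have [v /andP[v0 vb] zE] := right z zb z1.
  move: E; rewrite yE zE !Gcyc_right ?u0 ?v0 ?ltW// => /cycX_inj -> //; lra.
Qed.

Lemma Fcyc_right (R : realType) (b u : R) : 0 <= b <= 1 -> 0 <= u <= 1 - b ->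
  Fcyc b (cycX u) = 1 - expR b * u.
Proof.
move=> b01 ub; rewrite -(Gcyc_right ub).
apply: pinvKV; first exact: Gcyc_inj.
have := onem_expR_le1 b; have := expR_gt0 b.
by rewrite inE/= in_itv/=; move: ub => /andP[u0 ub] e0 e1; apply/andP; split; nra.
Qed.

Lemma Fcyc_left (R : realType) (b x : R) : 0 <= b <= 1 -> 0 <= x <= xbreak b ->
  Fcyc b x = expR (b - 1) * x.
Proof.
move=> b01 /andP[x0]; rewrite -Gcyc_break -ler_pdivrMr ?expR_gt0//.
rewrite -expRN opprB mulrC => xb.
rewrite -{1}[x](_ : Gcyc b (expR (b - 1) * x) = _).
  apply: pinvKV; first exact: Gcyc_inj.
  rewrite inE/= in_itv/= mulr_ge0 ?expR_ge0//=.
  apply: (le_trans xb); rewrite gerBl mulr_ge0 ?expR_ge0 ?subr_ge0//.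
  by case/andP: b01.
by rewrite Gcyc_left// mulrAC -expRD subrKA subrr expR0 mul1r.
Qed.

(** * The density on each side of the breakpoint *)

Lemma fcyc_left (R : realType) (b x : R) : 0 <= b <= 1 ->
  0 <= x < xbreak b -> derivable01 (Fcyc b) x /\ fcyc b x = expR (b - 1).
Proof.
move=> b01 /andP[x0 xb].
apply: (@derive01_near _ _ ( *%R (expR (b - 1)))).
- rewrite x0/= ltW//; apply: lt_le_trans xb _.
  by have /cycX_itv/andP[] : 0 <= 1 - b <= 1 by lra.
- near=> z => /andP[z0 _]; apply: Fcyc_left => //; rewrite z0/= ltW//.
  by near: z; exact: lt_nbhsl.
- by apply: is_derive_eq; rewrite [_ *: _]mulr1.
Unshelve. all: by end_near.
Qed.

Lemma fcyc_right (R : realType) (b u : R) : 0 <= b < 1 -> 0 <= u < 1 - b ->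
  derivable01 (Fcyc b) (cycX u) /\
  fcyc b (cycX u) = expR b * (expR 1 - expR u)^-1.
Proof.
move=> /andP[b0 b1] /andP[u0 ub].
have u1 : u < 1 by lra.
apply: (@derive01_near _ _ (fun x => 1 - expR b * cycU x)).
- by apply: cycX_itv; lra.
- near=> z => z01; have [v v01 vE] := cycX_surj z01.
  (* Since [u < 1 - b], the point [X u] lies strictly above [x_b], so every nearby [z] in [0, 1]
     stays on the right branch. *)
  have : xbreak b < z by near: z; apply: lt_nbhsr; rewrite ltr_cycX//; lra.
  rewrite -vE -[xbreak b]/(cycX (1 - b)) ltr_cycX; [move=> vb|lra..].
  by rewrite Fcyc_right ?cycUK; lra.
- have dU : is_derive (cycX u) 1 (@cycU R) (expR u - expR 1)^-1.
    by apply: is_derive_cycU; lra.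
  apply: is_derive_eq.
  by rewrite add0r mul1r -scalerN -invrN opprB.
Unshelve. all: by end_near.
Qed.

(** Replaces a point of [(x_b, 1]] by its parameter [u], in which the later estimates are carried
    out. *)
Lemma fcyc_right_surj (R : realType) (b x : R) :
  0 <= b < 1 -> xbreak b < x <= 1 ->
  exists u, [/\ 0 <= u, u < 1 - b, cycX u = x, derivable01 (Fcyc b) x &
    fcyc b x = expR b * (expR 1 - expR u)^-1].
Proof.
move=> b01 /andP[xb x1].
have x0 : 0 <= x.
  apply: le_trans (ltW xb).
  by have /cycX_itv/andP[] : 0 <= 1 - b <= 1 by lra.
have [u /andP[u0 u1] uE] : exists2 u, 0 <= u <= 1 & cycX u = x.
  by apply: cycX_surj; rewrite x0.
have ub : u < 1 - b.
  by move: xb; rewrite -uE -[xbreak b]/(cycX (1 - b)) ltr_cycX; lra.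
have [|dF fE] := @fcyc_right R b u b01; first by rewrite u0.
by exists u; split => //; rewrite -uE.
Qed.

(** * Monotonicity and convexity *)

(** X reverses the order, while [1 / (e - e^u)] increases with [u < 1]. *)
Lemma fcyc_decreasing (R : realType) (b : R) : 0 <= b < 1 ->
  {in `]xbreak b, 1] &, {homo fcyc b : x y /~ x < y}}.
Proof.
move=> b01 x y; rewrite !in_itv/= => xb yb yx.
have [u [u0 ub uE _ ->]] := fcyc_right_surj b01 xb.
have [v [v0 vb vE _ ->]] := fcyc_right_surj b01 yb.
have uv : u < v by move: yx; rewrite -uE -vE ltr_cycX; lra.
rewrite ltr_pM2l ?expR_gt0// ltf_pV2 ?posrE ?subr_gt0 ?ltr_expR; [|lra..].
by rewrite ltrD2l ltrN2 ltr_expR.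
Qed.

(** Take the supporting line at [w], where [X w = t x + (1 - t) y]. Averaging its bounds at [u] and
    [v] with weights [t] and [1 - t] cancels the slope terms. *)
Lemma fcyc_convex_comb (R : realType) (b t x y : R) :
  0 <= b < 1 -> 0 <= t <= 1 -> xbreak b < x <= 1 -> xbreak b < y <= 1 ->
  fcyc b (t * x + (1 - t) * y) <= t * fcyc b x + (1 - t) * fcyc b y.
Proof.
move=> b01 /andP[t0 t1] xb yb.
have zb : xbreak b < t * x + (1 - t) * y <= 1.
  have [->|tN0] := eqVneq t 0; first lra.
  have {tN0}t0 : 0 < t by rewrite lt0r tN0.
  move: xb yb => /andP[bx x1] /andP[by_ y1]; apply/andP; split; nra.
have [u [u0 ub uE _ ->]] := fcyc_right_surj b01 xb.
have [v [v0 vb vE _ ->]] := fcyc_right_surj b01 yb.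
have [w [w0 wb wE _ ->]] := fcyc_right_surj b01 zb.
rewrite !(mulrCA _ (expR b)) -mulrDr ler_pM2l ?expR_gt0//.
have [u1 v1 w1] : [/\ u < 1, v < 1 & w < 1] by split; lra.
have := cycX_tangent w1 u1; have := cycX_tangent w1 v1.
rewrite uE vE wE.
move: (_^-1) (_^-1) (_^-1) (expR w / _) => fv fw fu k hv hu.
nra.
Qed.

Lemma fcyc_convex (R : realType) (b : R) : 0 <= b < 1 ->
  @convex_function R R^o `]xbreak b, 1]%classic (fcyc b).
Proof.
move=> b01 t x y; rewrite !inE/= !in_itv/= => xb yb.
by apply: fcyc_convex_comb => //; apply/andP; split.
Qed.

(** * Right-hand limits at the breakpoint *)

(** For [b > 0] the parameter [1 - b] of [x_b] is below 1, so U is continuous at [x_b] and the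
    denominator [e - e^(1 - b)] is nonzero. *)
Lemma fcyc_break_right (R : realType) (b : R) : 0 < b < 1 ->
  fcyc b x @[x --> (xbreak b)^'+] --> expR (b - 1) / (1 - expR (- b)).
Proof.
move=> /andP[b0 b1].
have gap0 : expR 1 - expR (1 - b) != 0 by rewrite subr_eq0 gt_eqF// ltr_expR; lra.
have -> : expR (b - 1) / (1 - expR (- b)) = expR b * (expR 1 - expR (1 - b))^-1.
  rewrite !expRD !expRN; field.
  have eb : 1 < expR b by rewrite expR_gt1.
  have e1 := expR_gt0 (1 : R).
  by apply/and4P; split; rewrite gt_eqF//; nra.
apply: (@cvg_trans _ ((fun x => expR b * (expR 1 - expR (cycU x))^-1) @
    (xbreak b)^'+)).
  apply: near_eq_cvg; near=> x.
  have [||u [u0 ub <- _ ->]] := @fcyc_right_surj R b x.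
  - by rewrite ltW.
  - apply/andP; split => //; apply: ltW; near: x; apply: nbhs_right_lt.
    rewrite -[ltRHS](cycX0 R) -[xbreak b]/(cycX (1 - b)) ltr_cycX; lra.
  - by rewrite cycUK//; lra.
apply: cvg_at_right_filter.
have dU : is_derive (xbreak b) 1 (@cycU R) (expR (1 - b) - expR 1)^-1.
  by apply: is_derive_cycU; lra.
have Uc : cycU x @[x --> xbreak b] --> 1 - b.
  rewrite -[1 - b](@cycUK R); last lra.
  by apply: differentiable_continuous; apply/derivable1_diffP; exact: ex_derive.
apply: cvgMr; apply: cvgV => //; apply: cvgB; first exact: cvg_cst.
by apply: continuous_cvg Uc; exact: continuous_expR.
Unshelve. all: by end_near.
Qed.

Lemma fcyc0_break_right (R : realType) :
  fcyc 0 x @[x --> (xbreak (0 : R))^'+] --> +oo.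
Proof.
apply/cvgryPge => M.
(* Raising the bound to at least 1 keeps [e - 1 / N] positive, so its logarithm [c] satisfies
   [1 / (e - e^c) = N]. Points [x < X c] have parameter [u > c], hence density above [N]. *)
pose N := Num.max M 1.
have N1 : 1 <= N by rewrite le_max lexx orbT.
have e1 : 1 < expR 1 :> R by rewrite expR_gt1.
have N0 : 0 < N^-1 <= 1 by rewrite invr_gt0 invf_le1; lra.
pose c := ln (expR 1 - N^-1).
have cE : expR c = expR 1 - N^-1 by rewrite lnK// posrE; lra.
have c1 : c < 1 by rewrite -ltr_expR cE; lra.
near=> x.
have [||u [u0 u1 uE _ ->]] := @fcyc_right_surj R 0 x.
- by rewrite lexx ltr01.
- apply/andP; split => //; apply: ltW; near: x; apply: nbhs_right_lt.
  by rewrite -[ltRHS](cycX0 R) -[xbreak 0]/(cycX (1 - 0)) ltr_cycX; lra.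
rewrite expR0 mul1r.
have cu : c < u.
  have : x < cycX c.
    near: x; apply: nbhs_right_lt.
    by rewrite -[xbreak 0]/(cycX (1 - 0)) ltr_cycX; lra.
  by rewrite -uE ltr_cycX; lra.
have cu' : expR c < expR u by rewrite ltr_expR.
have u1' : expR u < expR 1 by rewrite ltr_expR; lra.
apply: (@le_trans _ _ N); first by rewrite le_max lexx.
rewrite -[N]invrK lef_pV2 ?posrE; lra.
Unshelve. all: by end_near.
Qed.

Theorem corollary1 (R : realType) :
  (forall x : R, 0 <= x <= 1 -> derivable01 (Fcyc 1) x /\ fcyc 1 x = 1) /\
  (forall b : R, 0 <= b < 1 ->
    [/\ (* the density exists away from the breakpoint *)
        forall x : R, 0 <= x <= 1 -> x != xbreak b -> derivable01 (Fcyc b) x,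
        (* (i) *)
        forall x : R, 0 <= x < xbreak b -> fcyc b x = expR (b - 1),
        (* (ii) *)
        (0 < b ->
          fcyc b x @[x --> (xbreak b)^'+] --> expR (b - 1) / (1 - expR (- b))) /\
        (b = 0 -> fcyc b x @[x --> (xbreak b)^'+] --> +oo),
        (* (iii) *)
        {in `]xbreak b, 1] &, {homo fcyc b : x y /~ x < y}} /\
        @convex_function R R^o `]xbreak b, 1]%classic (fcyc b)
      & (* (iv) *)
        fcyc b 1 = expR (b - 1) / (1 - expR (- 1))]).
Proof.
have xbreak1 : xbreak 1 = 1 :> R by rewrite /xbreak subrr expR0 mul0r subr0.
split=> [x x01|b b01].
  have b01 : 0 <= (1 : R) <= 1 by rewrite ler01 lexx.
  (* For [b = 1] the breakpoint is 1, so the left branch fills [0, 1] and F_1 is the identity there.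
     Comparing with [id] directly also covers [x = 1], which [fcyc_left] leaves out. *)
  have [|//] := @derive01_near _ (Fcyc 1) id x 1 x01.
  near=> z => z01; rewrite Fcyc_left ?xbreak1//.
  by rewrite subrr expR0 mul1r.
have b01' : 0 <= b <= 1 by lra.
split.
- move=> x /andP[x0 x1]; rewrite neq_lt => /orP[xb|xb].
    by have [] := @fcyc_left R b x b01'; rewrite ?x0.
  by have [|u []] := @fcyc_right_surj R b x b01; rewrite ?xb.
- by move=> x xb; have [] := fcyc_left b01' xb.
- split=> [b0|->]; last exact: fcyc0_break_right.
  by apply: fcyc_break_right; lra.
- by split; [exact: fcyc_decreasing|exact: fcyc_convex].
(* The endpoint 1 is [X 0], and [0 < 1 - b] puts it on the right branch. *)
- have [|_] := @fcyc_right R b 0 b01; first lra.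
  rewrite cycX0 => ->; rewrite expR0 expRD !expRN.
  field.
  have e1 : 1 < expR 1 :> R by rewrite expR_gt1.
  by apply/andP; split; rewrite gt_eqF//; lra.
Unshelve. all: by end_near.
Qed.
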